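(* Let $(\Delta_K,\Delta_G,\Delta_H)$ be a Zappa–Szép Garside structure for the Zappa–Szép product $K=G\bowtie H$. Given $g_1|\cdots|g_m\in\overline{\mathcal L}_G$ and $h_1|\cdots|h_n\in\overline{\mathcal L}_H$, the following algorithm computes the normal form (in $K$ with respect to $\Delta_K$) of $g_1\cdots g_mh_1\cdots h_n$. Initialise $W_G:=g_1|g_2|\cdots|g_m$ and $W_K:=h_1|h_2|\cdots|h_n$. While $W_G$ is not the empty word, do the following: 1. Remove the last letter $g$ from $W_G$ (so that $W_G$ becomes the word with that letter deleted). 2. Write each simple factor of $W_K$ as an $HG$-decomposition, $W_K=h'_1g'_1|h'_2g'_2|\cdots|h'_\ell g'_\ell$ with $h'_i\in H$, $g'_i\in G$. 3. If $g'_\ell=\mathbf 1$, replace $W_K$ by the word $gh'_1\,|\,g'_1h'_2\,|\cdots|\,g'_{\ell-1}h'_\ell$; otherwise replace $W_K$ by the word $gh'_1\,|\,g'_1h'_2\,|\cdots|\,g'_{\ell-1}h'_\ell\,|\,g'_\ell$. (If $W_K$ is the empty word, replace it by the one-letter word $g$.) Return $W_K$.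
   Context: Zappa–Szép product: for a monoid $K$ with submonoids $G,H$, write $K=G\bowtie H$ if for every $k\in K$ there exist unique $g_1,g_2\in G$ and $h_1,h_2\in H$ such that $g_1h_1=k=h_2g_2$; $k=h_2g_2$ is the $HG$-decomposition of $k$. Garside monoids: in a monoid $M$ with identity $\mathbf 1$, write $x\preccurlyeq y$ ($x$ is a prefix of $y$) if $y=xu$ for some $u\in M$, and $y\succcurlyeq x$ ($x$ is a suffix of $y$) if $y=ux$ for some $u\in M$. An atom is an element $a\neq\mathbf 1$ such that $a=uv$ implies $u=\mathbf 1$ or $v=\mathbf 1$. $M$ is atomic if it is generated by its atoms and for each $x\in M$ there is an upper bound on the lengths of decompositions of $x$ as a product of atoms. An element is balanced if its set of prefixes equals its set of suffixes; this common set is denoted $\mathrm{Div}(d)$. A Garside structure is a pair $(M,\Delta)$ where $M$ is a cancellative atomic monoid, the prefix and suffix relations are lattice orders, $\Delta\in M$ is balanced, $M$ is generated by $\mathrm{Div}(\Delta)$, and $\mathrm{Div}(\Delta)$ is finite. $M$ is a Garside monoid if such a $\Delta$ (a Garside element) exists. Zappa–Szép Garside structure: $(\Delta_K,\Delta_G,\Delta_H)$ is one for $K=G\bowtie H$ if $K$ is a Garside monoid (it then follows that $G$ and $H$ are Garside monoids), $\Delta_K,\Delta_G,\Delta_H$ are Garside elements of $K,G,H$ respectively, and $\Delta_K=\Delta_G\Delta_H$. Normal forms: for $M\in\{K,G,H\}$ let $\mathcal D_M=\mathrm{Div}(\Delta_M)$ (the simple elements) and, for $x\in\mathcal D_M$,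 let $\partial_Mx\in\mathcal D_M$ be the unique element with $x\,\partial_Mx=\Delta_M$. Let $\wedge$ denote the meet for the prefix order. $\overline{\mathcal L}_M$ is the set of all words $x_1.x_2.\cdots.x_n$ ($n\ge 0$, including the empty word) over the alphabet $\mathcal D_M\setminus\{\mathbf 1\}$ such that $\partial_Mx_i\wedge x_{i+1}=\mathbf 1$ for $1\le i<n$; $x_1|\cdots|x_n$ denotes such a word. The normal form of $x\in M$ is the unique word $x_1|\cdots|x_n\in\overline{\mathcal L}_M$ with $x=x_1\cdots x_n$. *)

(* Defs.v *)
From HB Require Import structures.
From mathcomp Require Import all_boot.
From mathcomp Require Import boolp classical_sets functions cardinality.

Set Implicit Arguments.
Unset Strict Implicit.
Unset Printing Implicit Defensive.

Local Open Scope classical_set_scope.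
Local Open Scope group_scope.

Section Garside.
Variable T : monoidType.

Definition word_prod (w : seq T) : T := \big[*%g/1]_(x <- w) x.

Definition is_submonoid (M : set T) : Prop :=
  M 1 /\ forall x y, M x -> M y -> M (x * y).

(* The notions below concern a submonoid [M] of [T] seen as a monoid in its
   own right: all the factors that they mention range over [M] only.  The
   ambient monoid itself is the case [M = setT]. *)

Definition prefix_of (M : set T) (x y : T) : Prop := exists2 u, M u & y = x * u.

Definition suffix_of (M : set T) (x y : T) : Prop := exists2 u, M u & y = u * x.

Definition is_atom (M : set T) (a : T) : Prop :=
  [/\ M a, a <> 1 &
      forall u v, M u -> M v -> a = u * v -> u = 1 \/ v = 1].

Definition word_over (X : set T) (w : seq T) : Prop := forall x, x \in w -> X x.

Definition generated_by (M X : set T) : Prop :=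
  forall x, M x -> exists2 w, word_over X w & x = word_prod w.

Definition is_atomic (M : set T) : Prop :=
  generated_by M (is_atom M) /\
  forall x, M x -> exists N : nat,
    forall w, word_over (is_atom M) w -> x = word_prod w -> (size w <= N)%N.

Definition is_cancellative (M : set T) : Prop :=
  (forall x y z, M x -> M y -> M z -> x * y = x * z -> y = z) /\
  (forall x y z, M x -> M y -> M z -> y * x = z * x -> y = z).

Definition is_glb (M : set T) (R : T -> T -> Prop) (x y m : T) : Prop :=
  [/\ M m, R m x, R m y & forall z, M z -> R z x -> R z y -> R z m].

Definition is_lub (M : set T) (R : T -> T -> Prop) (x y m : T) : Prop :=
  [/\ M m, R x m, R y m & forall z, M z -> R x z -> R y z -> R m z].

Definition is_lattice_order (M : set T) (R : T -> T -> Prop) : Prop :=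
  [/\ forall x, M x -> R x x,
      forall x y, M x -> M y -> R x y -> R y x -> x = y,
      forall x y z, M x -> M y -> M z -> R x y -> R y z -> R x z,
      forall x y, M x -> M y -> exists m, is_glb M R x y m &
      forall x y, M x -> M y -> exists m, is_lub M R x y m].

Definition is_balanced (M : set T) (d : T) : Prop :=
  [set x | M x /\ prefix_of M x d] = [set x | M x /\ suffix_of M x d].

Definition Div (M : set T) (d : T) : set T := [set x | M x /\ prefix_of M x d].

Record is_garside_structure (M : set T) (D : T) : Prop := GarsideStructure {
  garside_cancellative : is_cancellative M;
  garside_atomic : is_atomic M;
  garside_prefix_lattice : is_lattice_order M (prefix_of M);
  garside_suffix_lattice : is_lattice_order M (suffix_of M);
  garside_mem : M D;
  garside_balanced : is_balanced M D;
  garside_generated : generated_by M (Div M D);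
  garside_finite : finite_set (Div M D)
}.

Definition is_garside_monoid (M : set T) : Prop :=
  exists D, is_garside_structure M D.

(* [xget 1 P] picks an element of [P].  In a Garside structure, for [x] in
   [Div M D], there is exactly one candidate in [compl]; likewise in [meet] for
   [x] and [y] in [M].  The default value 1 is then never used. *)

Definition compl (M : set T) (D x : T) : T :=
  xget 1 [set y | Div M D y /\ x * y = D].

Definition meet (M : set T) (x y : T) : T :=
  xget 1 [set m | is_glb M (prefix_of M) x y m].

Definition normal_words (M : set T) (D : T) : set (seq T) :=
  [set w | word_over [set x | Div M D x /\ x <> 1] w /\
           sorted (fun x y => meet M (compl M D x) y == 1) w].

Definition is_normal_form (M : set T) (D x : T) (w : seq T) : Prop :=
  unique (fun v => normal_words M D v /\ x = word_prod v) w.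

Definition is_zappa_szep (G H : set T) : Prop :=
  [/\ is_submonoid G, is_submonoid H &
      forall k : T, exists! q : (T * T) * (T * T),
        let: ((g1, h1), (h2, g2)) := q in
        [/\ G g1, H h1, H h2 & G g2] /\ (g1 * h1 = k /\ k = h2 * g2)].

Record is_zappa_szep_garside (G H : set T) (DK DG DH : T) : Prop :=
  ZappaSzepGarside {
    zsg_monoid : is_garside_monoid setT;
    zsg_K : is_garside_structure setT DK;
    zsg_G : is_garside_structure G DG;
    zsg_H : is_garside_structure H DH;
    zsg_prod : DK = DG * DH
  }.

(* The pair (h, g); it exists and is unique in a Zappa-Szep product. *)
Definition HG_decomp (G H : set T) (k : T) : T * T :=
  xget (1, 1) [set p | [/\ H p.1, G p.2 & k = p.1 * p.2]].

(* With [hs] and [gs] the two components of the decompositions, [zip] drops the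
   last letter of [g :: gs] and pairs [g] with h'_1, then g'_i with h'_(i+1);
   the dropped letter [last g gs] is g'_l since [W] is not empty. *)
Definition zs_step (G H : set T) (g : T) (W : seq T) : seq T :=
  if W is [::] then [:: g] else
  let hs := [seq (HG_decomp G H k).1 | k <- W] in
  let gs := [seq (HG_decomp G H k).2 | k <- W] in
  let W' := [seq p.1 * p.2 | p <- zip (g :: gs) hs] in
  if last g gs == 1 then W' else rcons W' (last g gs).

(* [foldr] consumes [WG] from its last letter to its first one, as the
   recurrence equations [zs_loop_nil] and [zs_loop_rcons] show. *)
Definition zs_loop (G H : set T) (WG WK : seq T) : seq T :=
  foldr (zs_step G H) WK WG.

Lemma zs_loop_nil G H WK : zs_loop G H [::] WK = WK.
Proof. by []. Qed.

Lemma zs_loop_rcons G H WG g WK :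
  zs_loop G H (rcons WG g) WK = zs_loop G H WG (zs_step G H g WK).
Proof. by rewrite /zs_loop foldr_rcons. Qed.

End Garside.

(* Main.v *)
(* A word is normal iff it is greedy: for consecutive letters [x] and [y], no
   nontrivial prefix [z] of [y] makes [x * z] simple.  In a Zappa-Szep Garside
   structure DK = DG DH = DH DG, so products of a simple element of G and a
   simple element of H, in either order, are simple.  Since every z is a product
   of an element of G and one of H, greediness need only be tested on G and on
   H.  For the letters g h | g' h' produced by a step out of the greedy words
   h g' | h' g'' and (on the G side) g | h g':
   - a z in G dividing g' h' divides g'; if h z = w a with w in G and a in H,
     then w divides h g' and g w is simple, so w = 1, h z is in H and z = 1;
   - a z in H dividing g' h' has a lcm g' u = z v with g', where u in H divides
     h' and v is in G; if h z is simple then so is h z v = (h g') u, whence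
     u = 1, and g' = z v forces z = 1.
   The G side condition persists because the first letter of the current word
   has the form g_i h with h in H. *)

Require Import Defs.
From HB Require Import structures.
From mathcomp Require Import all_boot.
From mathcomp Require Import boolp classical_sets functions cardinality.

Set Implicit Arguments.
Unset Strict Implicit.
Unset Printing Implicit Defensive.

Local Open Scope classical_set_scope.
Local Open Scope group_scope.

(** * Greedy words and uniqueness of normal forms in a Garside monoid *)

Section GarsideTheory.
Variables (T : monoidType) (M : set T) (D : T).
Hypotheses (hM : is_submonoid M) (hD : is_garside_structure M D).

Lemma submonoid1 : M 1. Proof. by case: hM. Qed.

Lemma submonoidM x y : M x -> M y -> M (x * y).
Proof. by case: hM => _; apply. Qed.

Hint Resolve submonoid1 submonoidM : core.

Lemma garside_mulI x y z : M x -> M y -> M z -> x * y = x * z -> y = z.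
Proof. by case: (garside_cancellative hD) => h _; apply: h. Qed.

Lemma garside_mulIr x y z : M x -> M y -> M z -> y * x = z * x -> y = z.
Proof. by case: (garside_cancellative hD) => _; apply. Qed.

Lemma garside_prefix_antisym x y :
  M x -> M y -> prefix_of M x y -> prefix_of M y x -> x = y.
Proof. by case: (garside_prefix_lattice hD) => _ h _ _ _; apply: h. Qed.

Lemma garside_mul_eq1 x y : M x -> M y -> x * y = 1 -> x = 1 /\ y = 1.
Proof.
move=> Mx My xy1; have x1 : x = 1.
  apply: garside_prefix_antisym => //; first by exists y.
  by exists x; rewrite ?mul1g.
by move: xy1; rewrite x1 mul1g.
Qed.

Lemma DivE_suffix x : Div M D x <-> M x /\ suffix_of M x D.
Proof.
have h := garside_balanced hD; rewrite /is_balanced in h.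
by split=> hx; [change ([set x | M x /\ suffix_of M x D] x); rewrite -h
  | change ([set x | M x /\ prefix_of M x D] x); rewrite h].
Qed.

Lemma Div_mull x y : M x -> M y -> Div M D (x * y) -> Div M D x.
Proof.
by move=> Mx My [_ [u Mu ->]]; split=> //; exists (y * u); rewrite ?mulgA; auto.
Qed.

Lemma Div_mulr x y : M x -> M y -> Div M D (x * y) -> Div M D y.
Proof.
move=> Mx My /DivE_suffix[_ [u Mu e]]; apply/DivE_suffix; split=> //.
by exists (u * x); [auto | rewrite -mulgA].
Qed.

Lemma Div_top : Div M D D.
Proof.
by split; [exact: garside_mem | exists 1; rewrite ?mulg1; auto].
Qed.

Lemma complP x : Div M D x -> Div M D (compl M D x) /\ x * compl M D x = D.
Proof.
move=> [Mx [u Mu e]]; apply: (@xgetPex _ 1 [set y | Div M D y /\ x * y = D]).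
by exists u; split=> //; apply/DivE_suffix; split=> //; exists x.
Qed.

(** By cancellation, [z] divides [compl M D x] exactly when [x * z] is simple, so a trivial meet
    means that no nontrivial prefix of [y] can be moved into [x]. *)
Lemma meet_compl_eq1 x y : Div M D x -> M y ->
  meet M (compl M D x) y == 1 <->
  (forall z, M z -> prefix_of M z y -> Div M D (x * z) -> z = 1).
Proof.
move=> Dx My; have [[Mc Dc] xc] := complP Dx; have [Mx _] := Dx.
have [_ _ _ glb _] := garside_prefix_lattice hD.
have [Mm mc my mmax] :=
  @xgetPex _ 1 [set m | is_glb M (prefix_of M) _ y m] (glb _ _ Mc My).
rewrite -/(meet _ _ _) in Mm mc my mmax *; split=> [/eqP m1 z Mz zy [_ [t Mt e]]|h].
  have [//|u Mu /esym] := mmax _ Mz _ zy.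
    by exists t => //; apply: (@garside_mulI x); rewrite ?mulgA ?xc; auto.
  by rewrite m1 => /(garside_mul_eq1 Mz Mu)[].
apply/eqP/h => //; split; first by auto.
by case: mc => u Mu e; exists u => //; rewrite -mulgA -e.
Qed.

Lemma normal_words_cons x w : normal_words M D (x :: w) <->
  [/\ Div M D x, x <> 1, normal_words M D w &
     forall z, M z -> prefix_of M z (head 1 w) -> Div M D (x * z) -> z = 1].
Proof.
split=> [[wo so]|[Dx x1 [wo so] xw]].
  have [Dx x1] : Div M D x /\ x <> 1 by apply: wo; rewrite mem_head.
  have wo' : word_over [set x | Div M D x /\ x <> 1] w.
    by move=> z zw; apply: wo; rewrite inE zw orbT.
  split=> //; first by split=> //; exact: path_sorted so.
  case: w so wo' {wo} => [|y w] /= so wo z Mz.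
    (* For empty [w] the default head is 1, whose only prefix is 1. *)
    by case=> u Mu /esym /(garside_mul_eq1 Mz Mu)[].
  have [[My _] _] := wo y (mem_head _ _).
  by case/andP: so => /(meet_compl_eq1 Dx My) h _; apply: h.
split=> [z|]; first by rewrite inE => /orP[/eqP->//|/wo].
case: w wo so xw => [|y w] //= wo -> xw; rewrite andbT.
have [[My _] _] := wo y (mem_head _ _).
exact/(meet_compl_eq1 Dx My).
Qed.

Lemma word_prod_cons (x : T) w : word_prod (x :: w) = x * word_prod w.
Proof. by rewrite /word_prod big_cons. Qed.

Lemma normal_words_prod w : normal_words M D w -> M (word_prod w).
Proof.
elim: w => [_|x w IH /normal_words_cons[[Mx _] _ /IH Mw _]].
  by rewrite /word_prod big_nil.
by rewrite word_prod_cons; auto.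
Qed.

(** The least common right multiple of [x] and [z] divides [D] and the product of the word, so it is
    a simple [x * t] with [t] dividing the tail. By induction [t] divides the next letter, and
    greediness gives [t = 1]. *)
Lemma normal_words_head x w z : normal_words M D (x :: w) -> Div M D z ->
  prefix_of M z (word_prod (x :: w)) -> prefix_of M z x.
Proof.
elim: w x z => [|y w IH] x z /normal_words_cons[Dx _ nw xw] Dz.
  by rewrite word_prod_cons /word_prod big_nil mulg1.
rewrite word_prod_cons => zxw; have Mw := normal_words_prod nw.
have [[Mx xD] [Mz zD]] := (Dx, Dz).
have [_ _ _ _ lub] := garside_prefix_lattice hD.
have [m [Mm [t Mt mx] zm mmin]] := lub _ _ Mx Mz.
have [u Mu Du] := mmin _ (garside_mem hD) xD zD.
have [] := mmin _ (submonoidM Mx Mw) _ zxw; first by exists (word_prod (y :: w)).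
move=> v Mv; rewrite mx -mulgA => /garside_mulI yw.
have {}yw : prefix_of M t (word_prod (y :: w)) by exists v => //; apply: yw; auto.
have Dxt : Div M D (x * t) by rewrite -mx; split=> //; exists u.
have t1 : t = 1.
  by apply: xw => //=; apply: IH nw _ yw; exact: Div_mulr Dxt.
by move: zm; rewrite mx t1 mulg1.
Qed.

Lemma normal_words_inj v w : normal_words M D v -> normal_words M D w ->
  word_prod v = word_prod w -> v = w.
Proof.
have nil_cons x u : normal_words M D (x :: u) -> word_prod (x :: u) <> 1.
  move=> /normal_words_cons[[Mx _] x1 nu _]; rewrite word_prod_cons.
  by move=> /(garside_mul_eq1 Mx (normal_words_prod nu))[].
elim: v w => [|x v IH] [|y w] // nv nw e.
- by case: (nil_cons _ _ nw); rewrite -e /word_prod big_nil.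
- by case: (nil_cons _ _ nv); rewrite e /word_prod big_nil.
have /normal_words_cons[Dx _ nv' _] := nv.
have /normal_words_cons[Dy _ nw' _] := nw.
have [Mx _] := Dx; have [My _] := Dy.
have [Mv Mw] := (normal_words_prod nv', normal_words_prod nw').
have xy : x = y.
  apply: garside_prefix_antisym => //.
    apply: normal_words_head nw Dx _.
    by rewrite -e word_prod_cons; exists (word_prod v).
  apply: normal_words_head nv Dy _.
  by rewrite e word_prod_cons; exists (word_prod w).
move: e; rewrite xy !word_prod_cons => /(garside_mulI My Mv Mw) e.
by rewrite (IH w).
Qed.

End GarsideTheory.

Lemma is_submonoid_setT (T : monoidType) : is_submonoid [set: T].
Proof. by []. Qed.

(** * Factors, prefixes and suffixes in a Zappa-Szép product *)

Lemma zappa_szep_sym (T : monoidType) (G H : set T) :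
  is_zappa_szep G H -> is_zappa_szep H G.
Proof.
move=> [hG hH h]; split=> // k.
have [[[g1 h1] [h2 g2]] [[[? ? ? ?] [e1 e2]] u]] := h k.
exists ((h2, g2), (g1, h1)); split=> // [[[h2' g2'] [g1' h1']]] [[? ? ? ?] [e3 e4]].
by have [-> -> -> ->] : ((g1, h1), (h2, g2)) = ((g1', h1'), (h2', g2')) by apply: u.
Qed.

Section ZappaSzepTheory.
Variables (T : monoidType) (G H : set T).
Hypothesis hGH : is_zappa_szep G H.

Lemma zappa_szep_ex k : exists g h, [/\ G g, H h & k = g * h].
Proof.
have [_ _ /(_ k) [[[g1 h1] [h2 g2]] [[[? ? ? ?] [e1 e2]] _]]] := hGH.
by exists g1, h1.
Qed.

Lemma zappa_szep_uniq g h g' h' : G g -> H h -> G g' -> H h' ->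
  g * h = g' * h' -> g = g' /\ h = h'.
Proof.
move=> Gg Hh Gg' Hh' e.
have [_ _ /(_ (g * h)) [[[g1 h1] [h2 g2]] [[[? ? ? ?] [e1 e2]] u]]] := hGH.
have [<- <- ] : ((g1, h1), (h2, g2)) = ((g, h), (h2, g2)) by apply: u.
by have [<- <- ] : ((g1, h1), (h2, g2)) = ((g', h'), (h2, g2)) by apply: u.
Qed.

End ZappaSzepTheory.

Section ZappaSzepPrefix.
Variables (T : monoidType) (G H : set T).
Hypothesis hGH : is_zappa_szep G H.
Hypothesis unitfree : forall x y : T, x * y = 1 -> x = 1 /\ y = 1.

Let hHG := zappa_szep_sym hGH.
Let G1 : G 1. Proof. by case: hGH => [[]]. Qed.
Let GM x y : G x -> G y -> G (x * y). Proof. by case: hGH => [[_ h] _ _]; apply: h. Qed.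
Let H1 : H 1. Proof. by case: hGH => [_ []]. Qed.
Let HM x y : H x -> H y -> H (x * y). Proof. by case: hGH => [_ [_ h] _]; apply: h. Qed.

(** Bringing [x * y] into GH order leaves an H-part [h3], which must be 1. Then [h1 * h2 * g2 = g3]
    lies in G, and HG uniqueness gives [h1 * h2 = 1], so both vanish. *)
Lemma zappa_szep_factor x y : G (x * y) -> G x /\ G y.
Proof.
have [g1 [h1 [Gg1 Hh1 ->]]] := zappa_szep_ex hGH x.
have [h2 [g2 [Hh2 Gg2 ->]]] := zappa_szep_ex hHG y.
have [g3 [h3 [Gg3 Hh3 e]]] := zappa_szep_ex hGH (h1 * h2 * g2).
have -> : g1 * h1 * (h2 * g2) = g1 * g3 * h3 by rewrite -mulgA (mulgA h1) e mulgA.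
move=> Gxy; have [_ h31] : g1 * g3 * h3 = g1 * g3 /\ 1 = h3.
  by apply: (zappa_szep_uniq hGH); rewrite ?mulg1; auto.
have [/unitfree[-> ->] _] : h1 * h2 = 1 /\ g2 = g3.
  by apply: (zappa_szep_uniq hHG); rewrite ?e -?h31 ?mulg1 ?mul1g; auto.
by rewrite mulg1 mul1g.
Qed.

Lemma zappa_szep_prefix z g h : G z -> G g -> H h ->
  prefix_of setT z (g * h) -> prefix_of G z g.
Proof.
move=> Gz Gg Hh [u _]; have [g' [h' [Gg' Hh' ->]]] := zappa_szep_ex hGH u.
rewrite mulgA => e; have [-> _] : g = z * g' /\ h = h'.
  by apply: (zappa_szep_uniq hGH); auto.
by exists g'.
Qed.

Lemma zappa_szep_suffix z g h : G z -> G g -> H h ->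
  suffix_of setT z (h * g) -> suffix_of G z g.
Proof.
move=> Gz Gg Hh [u _]; have [h' [g' [Hh' Gg' ->]]] := zappa_szep_ex hHG u.
rewrite -mulgA => e; have [_ ->] : h = h' /\ g = g' * z.
  by apply: (zappa_szep_uniq hHG); auto.
by exists g'.
Qed.

Lemma zappa_szep_cap x : G x -> H x -> x = 1.
Proof.
move=> Gx Hx; have [] // : x = 1 /\ 1 = x.
by apply: (zappa_szep_uniq hGH); rewrite ?mulg1 ?mul1g.
Qed.

End ZappaSzepPrefix.

(** * Simple elements and their products in a Zappa-Szép Garside structure *)

Section ZappaSzepSimple.
Variables (T : monoidType) (G H : set T) (DK DG DH : T).
Hypotheses (hGH : is_zappa_szep G H) (hD : is_zappa_szep_garside G H DK DG DH).

Let hHG := zappa_szep_sym hGH.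
Let hT := is_submonoid_setT T.
Let hK := zsg_K hD.
Let unitfree (x y : T) : x * y = 1 -> x = 1 /\ y = 1.
Proof. exact: (garside_mul_eq1 hT hK). Qed.
Let mulI (x y z : T) : x * y = x * z -> y = z.
Proof. exact: (garside_mulI hK). Qed.
Let mulIr (x y z : T) : y * x = z * x -> y = z.
Proof. exact: (garside_mulIr hK). Qed.
Let hG : is_submonoid G. Proof. by case: hGH. Qed.
Let hH : is_submonoid H. Proof. by case: hGH. Qed.
Let G1 := submonoid1 hG.
Let GM := submonoidM hG.
Let H1 := submonoid1 hH.
Let HM := submonoidM hH.
Let S := Div setT DK.

Let simplel (x y : T) : S (x * y) -> S x.
Proof. exact: (Div_mull hT). Qed.
Let simpler (x y : T) : S (x * y) -> S y.
Proof. exact: (Div_mulr hT hK). Qed.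

Lemma simple_G g : Div G DG g <-> G g /\ S g.
Proof.
split=> [[Gg [u Gu e]]|[Gg [_ dg]]]; split=> //.
  by split=> //; exists (u * DH) => //; rewrite (zsg_prod hD) e mulgA.
move: dg; rewrite (zsg_prod hD); apply: (zappa_szep_prefix hGH) => //.
  exact: garside_mem (zsg_G hD).
exact: garside_mem (zsg_H hD).
Qed.

(** Suffixes are used because [DH] is the right factor in [DK = DG * DH]; [zsg_prod_sym], which puts
    it on the left, rests on this lemma. *)
Lemma simple_H h : Div H DH h <-> H h /\ S h.
Proof.
rewrite (DivE_suffix (zsg_H hD)) /S (DivE_suffix hK).
split=> [[Hh [u Hu e]]|[Hh [_ dh]]]; split=> //.
  by split=> //; exists (DG * u) => //; rewrite (zsg_prod hD) e mulgA.
move: dh; rewrite (zsg_prod hD); apply: (zappa_szep_suffix hHG) => //.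
  exact: garside_mem (zsg_H hD).
exact: garside_mem (zsg_G hD).
Qed.

Let GD : G DG := garside_mem (zsg_G hD).
Let HD : H DH := garside_mem (zsg_H hD).
Let SG : S DG. Proof. by have /simple_G[] := Div_top hG (zsg_G hD). Qed.
Let SH : S DH. Proof. by have /simple_H[] := Div_top hH (zsg_H hD). Qed.

(* The H-part and the G-part of [DK] on the HG side are the largest simple
   elements of H and of G, the latter by reading [DK] from the right. *)
Lemma zsg_prod_sym : DK = DH * DG.
Proof.
have [h [g [Hh Gg e]]] := zappa_szep_ex hHG DK.
have Sk : S (h * g) by rewrite -e; exact: (Div_top hT hK).
have [_ [t Ht eH]] : Div H DH h.
  by apply/simple_H; split=> //; exact: simplel Sk.
have /(DivE_suffix (zsg_G hD))[_ [s Gs eG]] : Div G DG g.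
  by apply/simple_G; split=> //; exact: simpler Sk.
have [_ pH] := SH.
move: pH; rewrite e => /(zappa_szep_prefix hHG HD Hh Gg)[r Hr er].
have /(DivE_suffix hK)[_] := SG.
rewrite e => /(zappa_szep_suffix hGH GD Gg Hh)[q Gq eq].
have [_ t1] : r = 1 /\ t = 1.
  by apply: unitfree; apply: (@mulI DH); rewrite mulgA -er -eH mulg1.
have [s1 _] : s = 1 /\ q = 1.
  by apply: unitfree; apply: (@mulIr DG); rewrite -mulgA -eq -eG mul1g.
by rewrite eG eH s1 t1 mulg1 mul1g.
Qed.

(** [h] extends on the left to [DH] and [g] on the right to [DG], so the product is a factor of
    [DH * DG = DK]. *)
Lemma simple_HG h g : H h -> S h -> G g -> S g -> S (h * g).
Proof.
move=> Hh Sh Gg Sg.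
have /simple_H/(DivE_suffix (zsg_H hD))[_ [h' _ eH]] := conj Hh Sh.
have /simple_G[_ [g' _ eG]] := conj Gg Sg.
apply: (@simpler h'); apply: (@simplel _ g').
by rewrite mulgA -eH -mulgA -eG -zsg_prod_sym; exact: (Div_top hT hK).
Qed.

Lemma simple_GH g h : G g -> S g -> H h -> S h -> S (g * h).
Proof.
move=> Gg Sg Hh Sh.
have /simple_G/(DivE_suffix (zsg_G hD))[_ [g' _ eG]] := conj Gg Sg.
have /simple_H[_ [h' _ eH]] := conj Hh Sh.
apply: (@simpler g'); apply: (@simplel _ h').
by rewrite mulgA -eG -mulgA -eH -(zsg_prod hD); exact: (Div_top hT hK).
Qed.

(* If [w] is the G-part of [z * DG] and [z' * z = DH], then
   [DK = z' * z * DG] makes [DG] the G-part of [z' * w], hence also of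
   [z' * DG] as [w] divides [DG]; comparing both forces [w = DG]. *)
Lemma garside_G_commute z : H z -> S z -> exists2 h, H h & z * DG = DG * h.
Proof.
move=> Hz Sz.
have [w [h [Gw Hh e]]] := zappa_szep_ex hGH (z * DG).
have Szh : S (z * DG) by apply: simple_HG.
have /simple_G[_ [r Gr er]] : G w /\ S w.
  by split=> //; apply: (@simplel _ h); rewrite -e.
have /simple_H/(DivE_suffix (zsg_H hD))[_ [z' Hz' eH]] := conj Hz Sz.
have [a [h4 [Ga Hh4 e4]]] := zappa_szep_ex hGH (z' * w).
have [eG _] : DG = a /\ DH = h4 * h.
  apply: (zappa_szep_uniq hGH) => //; first by auto.
  by rewrite -(zsg_prod hD) zsg_prod_sym eH -mulgA e mulgA e4 mulgA.
have [g6 [h6 [Gg6 Hh6 e6]]] := zappa_szep_ex hGH (h4 * r).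
have Sz' : S z'.
  by apply: (@simplel _ z); rewrite -eH.
have eD : z' * DG = DG * g6 * h6.
  by rewrite er mulgA e4 -eG -mulgA e6 mulgA -er.
have /simple_G[_ [v Gv ev]] : G (DG * g6) /\ S (DG * g6).
  split; first by auto.
  by apply: (@simplel _ h6); rewrite -eD; apply: simple_HG.
have [g61 _] : g6 = 1 /\ v = 1.
  by apply: unitfree; apply: (@mulI DG); rewrite mulgA -ev mulg1.
have [_ r1] : h4 = h6 /\ r = 1.
  by apply: (zappa_szep_uniq hHG); rewrite // e6 g61 mul1g mulg1.
by exists h => //; rewrite e er r1 mulg1.
Qed.

(** [z * DG = DG * h] is a common right multiple of [g] and [z]. Writing [DG * h] as [g * u * g3]
    and then [g * u] as [c * d], HG uniqueness identifies [c] with [z] and makes [d] a prefix of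
    [DG]. *)
Lemma simple_swap g z : G g -> S g -> H z -> S z ->
  exists u v, [/\ H u, G v, S v & g * u = z * v].
Proof.
move=> Gg Sg Hz Sz.
have [h Hh e] := garside_G_commute Hz Sz.
have /simple_G[_ [g2 Gg2 eg]] := conj Gg Sg.
have [u [g3 [Hu Gg3 e3]]] := zappa_szep_ex hHG (g2 * h).
have [c [d [Hc Gd e4]]] := zappa_szep_ex hHG (g * u).
have [cz dD] : z = c /\ DG = d * g3.
  apply: (zappa_szep_uniq hHG) => //; first by auto.
  by rewrite e eg -mulgA e3 mulgA e4 mulgA.
exists u, d; split=> //; last by rewrite e4 -cz.
by apply: (@simplel _ g3); rewrite -dD.
Qed.

(** The least common right multiple of [g] and [z] divides both [g * h] and the multiple from
    [simple_swap]. The first makes its cofactor over [g] a prefix of [h]; the second makes its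
    cofactor over [z] a simple element of G. *)
Lemma simple_swap_prefix g z h : G g -> S g -> H z -> S z -> H h ->
  prefix_of setT z (g * h) ->
  exists u v, [/\ H u, prefix_of setT u h, G v, S v & g * u = z * v].
Proof.
move=> Gg Sg Hz Sz Hh zgh.
have [u' [v' [Hu' Gv' Sv' e']]] := simple_swap Gg Sg Hz Sz.
have [_ _ _ _ lub] := garside_prefix_lattice hK.
have [m [_ [u _ mu] [v _ mv] mmin]] := lub g z I I.
have [] := mmin (g * u') I; [by exists u'|by rewrite e'; exists v'|move=> w _ ew].
have [] := mmin (g * h) I; [by exists h|by []|move=> w' _ ew'].
have hu : h = u * w' by apply: (@mulI g); rewrite mulgA -mu.
have hv : v' = v * w by apply: (@mulI z); rewrite mulgA -mv -e'.
have [Hu _] : H u /\ H w' by apply: (zappa_szep_factor hHG unitfree); rewrite -hu.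
have [Gv _] : G v /\ G w by apply: (zappa_szep_factor hGH unitfree); rewrite -hv.
exists u, v; split=> //; [by exists w'| |by rewrite -mu].
by apply: (@simplel _ w); rewrite -hv.
Qed.

(** * Greedy pairs of letters *)

Definition greedy (x y : T) : Prop :=
  forall z, prefix_of setT z y -> S (x * z) -> z = 1.

Lemma greedyS x y :
  (forall z, G z -> prefix_of setT z y -> S (x * z) -> z = 1) ->
  (forall z, H z -> prefix_of setT z y -> S (x * z) -> z = 1) -> greedy x y.
Proof.
move=> hg hh z [t _ e]; have [g [h [Gg Hh ez]]] := zappa_szep_ex hGH z.
rewrite ez => Sz; have g1 : g = 1.
  apply: hg => //; first by exists (h * t) => //; rewrite e ez mulgA.
  by apply: (@simplel _ h); rewrite -mulgA.
rewrite g1 mul1g in ez Sz *; apply: hh => //.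
by exists t; rewrite // -ez.
Qed.

Lemma greedy_step g h g' h' :
  G g -> S g -> H h -> S h -> G g' -> S g' -> H h' ->
  (forall z, G z -> prefix_of setT z (h * g') -> S (g * z) -> z = 1) ->
  greedy (h * g') h' -> greedy (g * h) (g' * h').
Proof.
move=> Gg Sg Hh Sh Gg' Sg' Hh' hg hx; apply: greedyS => z.
  move=> Gz /(zappa_szep_prefix hGH Gz Gg' Hh')[t Gt et] Sz.
  have [w [a [Gw Ha e]]] := zappa_szep_ex hGH (h * z).
  have w1 : w = 1.
    apply: hg => //; first by exists (a * t); rewrite // et !mulgA e.
    by apply: (@simplel _ a); rewrite -mulgA -e mulgA.
  have [_ ->//] : h = a /\ z = 1.
  by apply: (zappa_szep_uniq hHG); rewrite // e w1 mul1g mulg1.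
move=> Hz pz Sz; have Shz : S (h * z) by apply: (@simpler g); rewrite mulgA.
have Sz' := simpler Shz.
have [u [v [Hu pu Gv Sv e]]] := simple_swap_prefix Gg' Sg' Hz Sz' Hh' pz.
have u1 : u = 1.
  by apply: hx => //; rewrite -mulgA e mulgA; apply: simple_HG => //; auto.
have [<-//] : 1 = z /\ g' = v.
by apply: (zappa_szep_uniq hHG); rewrite // -e u1 mul1g mulg1.
Qed.

(** * One pass of the algorithm, then the loop *)

Lemma HG_decompP k : let p := HG_decomp G H k in
  [/\ H p.1, G p.2 & k = p.1 * p.2].
Proof.
have [h [g [Hh Gg e]]] := zappa_szep_ex hHG k.
apply: (@xgetPex _ (1, 1) [set p | [/\ H p.1, G p.2 & k = p.1 * p.2]]).
by exists (h, g).
Qed.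

(* A structurally recursive form of [zs_step]; it differs from it when [W] is
   empty and [g] is 1. *)
Fixpoint push_step (g : T) (W : seq T) : seq T :=
  if W is k :: W' then
    g * (HG_decomp G H k).1 :: push_step (HG_decomp G H k).2 W'
  else if g == 1 then [::] else [:: g].

Lemma zs_stepE g W : g <> 1 -> zs_step G H g W = push_step g W.
Proof.
move=> /eqP/negPf g1.
(* Stated for every [a], since in the induction the carried G-part may be 1. *)
have cons_step a k W' : zs_step G H a (k :: W') = push_step a (k :: W').
  rewrite /zs_step; elim: W' a k => [|k' W' IH] a k /=; first by case: eqP.
  by move: (IH (HG_decomp G H k).2 k') => /= <-; case: ifP.
by case: W => [|k W]; [rewrite /= g1 | exact: cons_step].
Qed.

Lemma push_step_prod g W : word_prod (push_step g W) = g * word_prod W.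
Proof.
elim: W g => [|k W IH] g /=.
  by rewrite /word_prod big_nil mulg1; case: eqP => [->|_]; rewrite ?big_nil ?big_seq1.
have [_ _ e] := HG_decompP k.
by rewrite !word_prod_cons IH {3}e !mulgA.
Qed.

(** For empty [W] this rests on the default head 1, whose H-part is 1. *)
Lemma head_push_step g W :
  head 1 (push_step g W) = g * (HG_decomp G H (head 1 W)).1.
Proof.
case: W => [|k W] //=; have [Hh Gg e] := HG_decompP 1.
have /unitfree[-> _] := esym e.
by rewrite mulg1; case: eqP.
Qed.

(** The carried [g] may be 1, as the induction needs. The condition on G-prefixes passes to [g']: if
    [g' * z] is simple, so is [k * z = h * (g' * z)], and greediness of [W] gives [z = 1]. *)
Lemma push_step_normal g W : G g -> S g -> normal_words setT DK W ->
  (forall z, G z -> prefix_of setT z (head 1 W) -> S (g * z) -> z = 1) ->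
  normal_words setT DK (push_step g W).
Proof.
have nil_normal : normal_words setT DK [::] by [].
elim: W g => [|k W IH] g Gg Sg /= nW gW.
  case: eqP => // g1; apply/(normal_words_cons hT hK); split=> // z _ [u _ /esym].
  by move=> /unitfree[].
have /(normal_words_cons hT hK)[Sk k1 nW' kW] := nW.
have [Hh Gg' ek] := HG_decompP k.
set h := (HG_decomp G H k).1 in Hh ek *; set g' := (HG_decomp G H k).2 in Gg' ek *.
have Sh : S h by apply: (@simplel _ g'); rewrite -ek.
have Sg' : S g' by apply: (@simpler h); rewrite -ek.
apply/(normal_words_cons hT hK); split; first exact: simple_GH.
(* If [g * h = 1], then [k] is [g'], a G-prefix of itself, and the head condition forces [k = 1]. *)
- move=> /unitfree[g1 h1]; apply: k1; apply: gW; last by rewrite g1 mul1g.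
    by rewrite ek h1 mul1g.
  by exists 1; rewrite ?mulg1.
- apply: IH => // z Gz zW Sz; apply: kW => //.
  by rewrite ek -mulgA; apply: simple_HG => //; auto.
rewrite head_push_step; have [Hh'' _ e''] := HG_decompP (head 1 W).
move=> z _; apply: greedy_step => //; rewrite -ek //.
move=> y [u _ ey]; apply: kW => //.
by eexists; last by rewrite e'' ey -mulgA.
Qed.

(** A G-prefix of an element of H lies in both submonoids, hence is 1; an H-prefix is a prefix
    within H, where the word is already greedy. *)
Lemma normal_words_H hs : normal_words H DH hs -> normal_words setT DK hs.
Proof.
elim: hs => [|h hs IH] //.
move=> /(normal_words_cons hH (zsg_H hD))[/simple_H[Hh Sh] h1 nhs hhs].
apply/(normal_words_cons hT hK); split=> //; first exact: IH.
have Hd : H (head 1 hs).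
  by case: hs nhs {hhs IH} => [|x w] // /(normal_words_cons hH (zsg_H hD))[[]].
move=> z _; apply: greedyS z => z.
  move=> Gz [u _ eu] _; apply: (zappa_szep_cap hGH Gz).
  by have [] : H z /\ H u by apply: (zappa_szep_factor hHG unitfree); rewrite -eu.
move=> Hz pz Shz; apply: hhs => //; last by apply/simple_H; auto.
by apply: (zappa_szep_prefix hHG) G1 _; rewrite ?mulg1.
Qed.

(** The last conjunct is an invariant: a G-prefix of [head 1 gs * h] divides [head 1 gs], so
    normality of the G-word supplies the condition of [push_step_normal]. *)
Lemma zs_loop_normal gs hs : normal_words G DG gs -> normal_words H DH hs ->
  [/\ normal_words setT DK (zs_loop G H gs hs),
      word_prod (zs_loop G H gs hs) = word_prod gs * word_prod hs &
      exists2 h, H h & head 1 (zs_loop G H gs hs) = head 1 gs * h].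
Proof.
move=> ngs nhs; elim: gs ngs => [_|g gs IH].
  split; [exact: normal_words_H|by rewrite /word_prod big_nil mul1g|].
  exists (head 1 hs); last by rewrite mul1g.
  by case: hs nhs => [|x w] // /(normal_words_cons hH (zsg_H hD))[[]].
move=> /(normal_words_cons hG (zsg_G hD))[/simple_G[Gg Sg] g1 ngs ggs].
have [nW eW [h Hh eh]] := IH ngs.
rewrite /= zs_stepE //; split.
- apply: push_step_normal => // z Gz; rewrite eh => pz Sgz.
  apply: ggs => //; last by apply/simple_G; auto.
  apply: (zappa_szep_prefix hGH) Hh pz => //.
  by case: gs ngs {IH nW eW eh} => [|x w] // /(normal_words_cons hG (zsg_G hD))[[]].
- by rewrite push_step_prod eW word_prod_cons mulgA.
rewrite head_push_step; eexists; last by [].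
by case: (HG_decompP (head 1 (zs_loop G H gs hs))).
Qed.

End ZappaSzepSimple.

Theorem proposition53 (K : monoidType) (G H : set K) (DK DG DH : K)
    (hKGH : is_zappa_szep G H)
    (hD : is_zappa_szep_garside G H DK DG DH)
    (gs hs : seq K)
    (hgs : normal_words G DG gs) (hhs : normal_words H DH hs) :
  is_normal_form setT DK (word_prod gs * word_prod hs)%g
    (zs_loop G H gs hs).
Proof.
have [nW eW _] := zs_loop_normal hKGH hD hgs hhs.
split=> // v [nv ev].
by apply: (normal_words_inj (is_submonoid_setT K) (zsg_K hD)); rewrite // eW.
Qed.
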